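(* Let $G$ be a finitely generated group, $R$ a commutative $\mathbb{Q}$-algebra, and $Z\in\mathscr{C}(G,R)$ a class function of $G$ with values in $R$. For a positive integer $n$ let $Z_n=Z\wr S_n$ be the orbifold transform of $Z$ by the symmetric group $S_n$ of degree $n$, and let $Z_0$ be the constant class function equal to $1$. Then the following formal identity holds: $$\sum_{n=0}^{\infty}Z_n(G)=\exp\left(\sum_{H\in\mathscr{L}(G)}\frac{Z(H)}{[G:H]}\right),$$ where the exponential on the right-hand side stands for its infinite power series. Here the identity is understood formally, with $Z_n(G)$ graded by $n$ and $Z(H)$ graded by the index $[G:H]$; that is, in the ring $R[[p]]$ of formal power series in a variable $p$, $$\sum_{n=0}^{\infty}p^n Z_n(G)=\exp\left(\sum_{H\in\mathscr{L}(G)}\frac{p^{[G:H]}Z(H)}{[G:H]}\right).$$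
   Context: A commutative $\mathbb{Q}$-algebra is a commutative ring with identity containing an isomorphic copy of the field of rational numbers. For a finitely generated group $G$, $\mathscr{L}(G)$ denotes the set of finite index subgroups of $G$ (there are only finitely many of each given index). A class function with values in $R$ is a map $Z:\mathscr{L}(G)\to R$ with $Z(g^{-1}Hg)=Z(H)$ for all $g\in G$, $H\in\mathscr{L}(G)$; the set of these is denoted $\mathscr{C}(G,R)$. Orbifold transform: for $Z\in\mathscr{C}(G,R)$ and a permutation group $\Omega<S_X$ acting on a finite set $X$, $Z\wr\Omega:\mathscr{L}(G)\to R$ is the class function $$(Z\wr\Omega)(H)=\frac{1}{|\Omega|}\sum_{\phi:H\to\Omega}\ \prod_{\xi\in\mathcal{O}(\phi)}Z(H_\xi),$$ where the sum runs over all group homomorphisms $\phi:H\to\Omega$, $\mathcal{O}(\phi)$ is the set of orbits of $\phi(H)$ on $X$, and $H_\xi=\{g\in H : \phi(g)\xi^*=\xi^*\}$ for an arbitrarily chosen representative $\xi^*\in\xi$ (the value $Z(H_\xi)$ does not depend on this choice). The symmetric group $S_n$ is regarded as a permutation group acting on $n$ points. *)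

(* Defs.v *)
From HB Require Import structures.
From mathcomp Require Import all_boot all_order all_algebra all_fingroup finmap.
From mathcomp Require Import boolp classical_sets functions cardinality fsbigop.

Set Implicit Arguments.
Unset Strict Implicit.
Unset Printing Implicit Defensive.

Import GRing.Theory.

Local Open Scope classical_set_scope.
Local Open Scope ring_scope.

(* Formal power series. The alias hides the pointwise ring structure that    *)
(* functions already carry: multiplication on fps R is the Cauchy product.   *)

Definition fps (R : comNzRingType) : Type := nat -> R.

Section FormalPowerSeries.
Variable R : comNzRingType.
Implicit Types f g h : fps R.

HB.instance Definition _ := Choice.copy (fps R) (nat -> R).
HB.instance Definition _ := GRing.Zmodule.copy (fps R) (nat -> R).

Definition fps_one : fps R := fun n => (n == 0%N)%:R.

Definition fps_mul f g : fps R := fun n => \sum_(i < n.+1) f i * g (n - i)%N.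

Definition fps_trunc (N : nat) f : {poly R} := \poly_(i < N) f i.

Lemma fps_mul_trunc N n f g : (n < N)%N ->
  fps_mul f g n = (fps_trunc N f * fps_trunc N g)`_n.
Proof.
move=> nN; rewrite coefM; apply: eq_bigr => -[i /= ile] _; rewrite !coef_poly.
by rewrite (leq_trans ile nN) (leq_ltn_trans (leq_subr i n) nN).
Qed.

Lemma fps_trunc_mul_coef N n f g : (n < N)%N ->
  (fps_trunc N (fps_mul f g))`_n = (fps_trunc N f * fps_trunc N g)`_n.
Proof. by move=> nN; rewrite coef_poly nN; exact: fps_mul_trunc. Qed.

Lemma fps_mulA : associative fps_mul.
Proof.
move=> f g h; apply/funext => n.
rewrite !(@fps_mul_trunc n.+1)//.
transitivity ((fps_trunc n.+1 f * (fps_trunc n.+1 g * fps_trunc n.+1 h))`_n).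
  rewrite !coefM; apply: eq_bigr => -[i /= ile] _; congr (_ * _).
  by rewrite fps_trunc_mul_coef// ltnS leq_subr.
rewrite mulrA !coefM; apply: eq_bigr => -[i /= ile] _; congr (_ * _).
by rewrite fps_trunc_mul_coef.
Qed.

Lemma fps_mulC : commutative fps_mul.
Proof.
by move=> f g; apply/funext => n; rewrite !(@fps_mul_trunc n.+1)// mulrC.
Qed.

Lemma fps_mul1 : left_id fps_one fps_mul.
Proof.
move=> f; apply/funext => n; rewrite /fps_mul big_ord_recl subn0 mul1r.
by rewrite big1 ?addr0// => i _; rewrite mul0r.
Qed.

Lemma fps_mulDl : left_distributive fps_mul +%R.
Proof.
move=> f g h; apply/funext => n; rewrite /fps_mul.
transitivity (\sum_(i < n.+1) (f i * h (n - i)%N + g i * h (n - i)%N)).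
  by apply: eq_bigr => i _; exact: mulrDl.
by rewrite big_split.
Qed.

Lemma fps_one_neq0 : fps_one != 0 :> fps R.
Proof.
by apply/eqP => /(congr1 (fun f : fps R => f 0%N)) /eqP; rewrite (oner_eq0 R).
Qed.

HB.instance Definition _ := GRing.Zmodule_isComNzRing.Build (fps R)
  fps_mulA fps_mulC fps_mul1 fps_mulDl fps_one_neq0.

Definition fps_scale (c : R) f : fps R := fun n => c * f n.

Lemma fps_scaleA a b f : fps_scale a (fps_scale b f) = fps_scale (a * b) f.
Proof. by apply/funext => n; exact: mulrA. Qed.

Lemma fps_scale1 : left_id 1 fps_scale.
Proof. by move=> f; apply/funext => n; exact: mul1r. Qed.

Lemma fps_scaleDr : right_distributive fps_scale +%R.
Proof. by move=> c f g; apply/funext => n; exact: mulrDr. Qed.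

Lemma fps_scaleDl f : {morph fps_scale^~ f : a b / a + b}.
Proof. by move=> a b; apply/funext => n; exact: mulrDl. Qed.

HB.instance Definition _ := GRing.Zmodule_isLmodule.Build R (fps R)
  fps_scaleA fps_scale1 fps_scaleDr fps_scaleDl.

Lemma fps_scaleAl a f g : a *: (f * g) = (a *: f) * g.
Proof.
apply/funext => n.
change (a * (\sum_(i < n.+1) f i * g (n - i)%N) =
  \sum_(i < n.+1) a * f i * g (n - i)%N).
by rewrite mulr_sumr; apply: eq_bigr => i _; exact: mulrA.
Qed.

HB.instance Definition _ :=
  GRing.Lmodule_isLalgebra.Build R (fps R) fps_scaleAl.

Definition fps_var : fps R := fun n => (n == 1%N)%:R.

(* Sum of a family of power series that is locally finite on A, i.e. such    *)
(* that every coefficient is nonzero for finitely many members only. As      *)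
(* always with \sum_(i \in A), a coefficient with infinite support gets the  *)
(* value 0.                                                                  *)
Definition fps_sum (I : choiceType) (A : set I) (F : I -> fps R) : fps R :=
  fun n => \sum_(i \in A) F i n.

End FormalPowerSeries.

(* Meaningful when f has no constant term: the powers of f are then locally  *)
(* finite.                                                                   *)
Definition fps_exp (R : comAlgType rat) (f : fps R) : fps R :=
  fps_sum [set: nat] (fun k => ((k`!%:R^-1 : rat)%:A : R) *: f ^+ k).

Section OrbifoldTransform.
Variable G : groupType.
Implicit Types H K : set G.

Definition subgroup H : Prop := group_closed [in H].

Definition finitely_generated : Prop :=
  exists s : seq G, forall H, subgroup H -> [set` s] `<=` H -> H = [set: G].

Definition left_cosets H : set (set G) :=
  [set [set (g * h)%g | h in H] | g in [set: G]].

(* [G : H], with value 0 if the index is infinite.                           *)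
Definition index_in H : nat := #|` fset_set (left_cosets H)|.

Definition finite_index_subgroups : set (set G) :=
  [set H | subgroup H /\ finite_set (left_cosets H)].

Definition conjugate H (g : G) : set G := [set (g^-1 * h * g)%g | h in H].

(* Class functions are total on set G; their values matter, and are          *)
(* constrained, only on finite_index_subgroups.                              *)
Definition class_function (R : Type) (Z : set G -> R) : Prop :=
  forall (g : G) H, finite_index_subgroups H -> Z (conjugate H g) = Z H.

Variables (X : finType) (Omega : {group {perm X}}).

(* The homomorphisms H -> Omega, each represented by the function on G which *)
(* extends it by 1 outside H.                                                *)
Definition homs H : set (G -> {perm X}) :=
  [set phi | [/\ forall g, H g -> phi g \in Omega,
                 forall g h, H g -> H h -> phi (g * h)%g = (phi g * phi h)%g &
                 forall g, ~ H g -> phi g = 1%g]].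

Definition hom_image H (phi : G -> {perm X}) : {set {perm X}} :=
  finset (fun s => `[< exists2 g, H g & phi g = s >]).

Definition hom_orbits H (phi : G -> {perm X}) : {set {set X}} :=
  imset (orbit 'P (hom_image H phi)) (mem [set: X]%SET).

Definition hom_stab H (phi : G -> {perm X}) (x : X) : set G :=
  [set g | H g /\ phi g x = x].

(* The pick chooses the representative of the orbit xi; the default value is *)
(* never used, since orbits are nonempty.                                    *)
Definition orbifold_transform (R : comAlgType rat) (Z : set G -> R) H : R :=
  (#|Omega|%:R^-1 : rat) *:
    \sum_(phi \in homs H) \prod_(xi in hom_orbits H phi)
      (if [pick x in xi] is Some x then Z (hom_stab H phi x) else 1).

End OrbifoldTransform.

Definition sym_transform (G : groupType) (R : comAlgType rat)
    (Z : set G -> R) (n : nat) : set G -> R :=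
  if n is 0 then fun=> 1
  else orbifold_transform [set: {perm 'I_n}]%G Z.

(* Main.v *)
(* Put a_n := Z_n(G). Multiplied by n!, it is the sum of the weights
   prod_xi Z(G_xi) over all actions of G on n points. Choosing a point x of the
   action and splitting off its orbit, which is the coset action of the
   stabilizer H of x, gives
     n a_n = sum_(k = 1 .. n) (sum_([G:H] = k) Z(H)) a_(n-k).
   With B := sum_H p^[G:H] Z(H) / [G:H] this says p A' = p B' A, hence
   A = exp B. The factorials are obtained by double counting the bijections
   from the disjoint union of G/H and n-k points to the n points which extend
   the orbit map of x. *)

Require Import Defs.
From mathcomp Require Import all_boot all_order all_algebra all_fingroup finmap.
From mathcomp Require Import boolp classical_sets functions cardinality fsbigop.

Local Open Scope classical_set_scope.
Local Open Scope ring_scope.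

(** * Formal exponentials: the recursion for the coefficients of [fps_exp] *)

Section FormalExponential.
Set Implicit Arguments.
Unset Strict Implicit.
Import GRing.Theory.

Lemma fps_mulE (R : comNzRingType) (f g : fps R) n :
  (f * g) n = \sum_(i < n.+1) f i * g (n - i)%N.
Proof. by []. Qed.

Lemma fps_var_expE (R : comNzRingType) m n :
  (fps_var R ^+ m) n = (n == m)%:R.
Proof.
elim: m n => [//|m IHm] [|n].
  by rewrite exprS fps_mulE big_ord1 mul0r.
rewrite exprS fps_mulE big_ord_recl mul0r add0r big_ord_recl mul1r subSS subn0.
by rewrite IHm big1 ?addr0// => i _; rewrite mul0r.
Qed.

Lemma fps_sum_monomials (R : comNzRingType) (I : choiceType) (A : set I)
    (c : I -> R) (d : I -> nat) n :
  fps_sum A (fun i => c i *: fps_var R ^+ d i) n =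
  \sum_(i \in A `&` [set i | d i = n]) c i.
Proof.
rewrite fsbig_mkcondr; apply: eq_fsbigr => i _.
have -> : (c i *: fps_var R ^+ d i) n = c i * (fps_var R ^+ d i) n by [].
rewrite fps_var_expE eq_sym; case: (eqVneq (d i) n) => [dn|dn].
  by rewrite mulr1 mem_set.
by rewrite mulr0 memNset// => /eqP; rewrite (negPf dn).
Qed.

(** Each factor [f] raises the order by at least one, so [f ^+ k] has order at least [k]; the powers
    of [f] are therefore locally finite. *)
Lemma fps_exp_coef0 (R : comNzRingType) (f : fps R) k n :
  f 0%N = 0 -> (n < k)%N -> (f ^+ k) n = 0.
Proof.
move=> f0; elim: k n => [//|k IHk] n; rewrite ltnS => nk.
rewrite exprS fps_mulE big1// => -[[|i] /= ile] _; first by rewrite f0 mul0r.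
rewrite IHk ?mulr0//; apply: leq_trans nk.
by rewrite ltn_subrL; case: (n) ile.
Qed.

Lemma fps_mulrnE (R : comNzRingType) (f : fps R) m n : (f *+ m) n = f n *+ m.
Proof. by elim: m => [//|m IHm]; rewrite !mulrSr -IHm. Qed.

(* The operator p d/dp. *)
Definition fps_euler (R : comNzRingType) (f : fps R) : fps R :=
  fun n => n%:R * f n.

(** Leibniz rule: in each term of the Cauchy product the weight [n] splits as [i + (n - i)]. *)
Lemma fps_eulerM (R : comNzRingType) (f g : fps R) :
  fps_euler (f * g) = fps_euler f * g + f * fps_euler g.
Proof.
apply/funext => n.
have -> : (fps_euler f * g + f * fps_euler g) n =
  (fps_euler f * g) n + (f * fps_euler g) n by [].
rewrite /fps_euler !fps_mulE big_distrr -big_split.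
apply: eq_bigr => -[i/= ile] _.
rewrite [f i * (_ * _)]mulrCA -[(i%:R * _) * _]mulrA -mulrDl -natrD subnKC//.
Qed.

Lemma fps_eulerX (R : comNzRingType) (f : fps R) k :
  fps_euler (f ^+ k.+1) = (fps_euler f * f ^+ k) *+ k.+1.
Proof.
elim: k => [|k IHk]; first by rewrite mulr1.
by rewrite exprS fps_eulerM IHk mulrnAr [RHS]mulrS mulrCA -exprS.
Qed.

Section Exp.
Variables (R : comAlgType rat) (f : fps R).
Hypothesis f0 : f 0%N = 0.

(** Powers beyond the order bound do not reach coefficient [n]. The cutoff [N] is left free so that
    several coefficients can share one range of summation. *)
Lemma fps_expE N n : (n < N)%N ->
  fps_exp f n = \sum_(k < N) (k`!%:R^-1 : rat) *: (f ^+ k) n.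
Proof.
move=> nN; rewrite (fsbig_ord _ _ (fun k => (k`!%:R^-1 : rat) *: (f ^+ k) n)).
rewrite /fps_exp /fps_sum [RHS](@fsbig_widen _ _ _ _ _ [set: nat])//;
  last first.
  move=> k [_ /negP/= kN]; rewrite fps_exp_coef0 ?scaler0//.
  by rewrite (leq_trans nN)// leqNgt.
by apply: eq_fsbigr => k _; exact: mulr_algl.
Qed.

(** This is p E' = (p f') E for E = exp f, read at coefficient [n]. The Euler derivative has no
    constant term, hence the shift to [i.+1]. *)
Lemma fps_exp_rec n : n%:R * fps_exp f n =
  \sum_(i < n) (i.+1%:R * f i.+1) * fps_exp f (n - i.+1)%N.
Proof.
transitivity (\sum_(k < n) (k`!%:R^-1 : rat) *: (fps_euler f * f ^+ k) n).
  rewrite (@fps_expE n.+1)// big_distrr big_ord_recl/= -scalerAr.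
  have -> : n%:R * (f ^+ 0) n = 0.
    by case: (n) => [|m]; [exact: mul0r|exact: mulr0].
  rewrite scaler0 add0r; apply: eq_bigr => k _; rewrite -scalerAr.
  have -> : n%:R * (f ^+ k.+1) n = (fps_euler f * f ^+ k) n *+ k.+1.
    have -> : n%:R * (f ^+ k.+1) n = fps_euler (f ^+ k.+1) n by [].
    by rewrite fps_eulerX fps_mulrnE.
  (* The power rule gives the factor [k.+1], which turns [1 / k.+1!] into [1 / k!]. *)
  rewrite -scaler_nat scalerA factS natrM invfM mulrAC mulVf ?mul1r//.
  by rewrite Num.Theory.pnatr_eq0.
under eq_bigr => k _ do rewrite fps_mulE scaler_sumr.
rewrite exchange_big/= big_ord_recl/= big1 ?add0r; last first.
  by move=> k _; rewrite /fps_euler mul0r mul0r scaler0.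
(* The cutoff [n] suffices since [n - i.+1 < n], and it matches the range of [k] on the other
   side. *)
apply: eq_bigr => i _; rewrite (@fps_expE n); last first.
  by rewrite ltn_subrL; exact: leq_trans (ltn_ord i).
rewrite big_distrr/=; apply: eq_bigr => k _.
by rewrite -[RHS]scalerAr /fps_euler /bump leq0n add1n.
Qed.

(** For positive [n] the recursion expresses [n * a n] through earlier values, and [n] is invertible
    in a rational algebra. *)
Lemma fps_exp_unique (a : nat -> R) : a 0%N = 1 ->
  (forall n, n%:R * a n = \sum_(i < n) (i.+1%:R * f i.+1) * a (n - i.+1)%N) ->
  fps_exp f = a.
Proof.
move=> a0 aE; apply/funext; elim/ltn_ind => -[_|n IHn].
  by rewrite a0 (@fps_expE 1)// big_ord1 invr1 scale1r.
have nN0 : (n.+1%:R : rat) != 0 by rewrite Num.Theory.pnatr_eq0.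
apply: (scalerI nN0); rewrite !scaler_nat -[LHS]mulr_natl -[RHS]mulr_natl.
rewrite fps_exp_rec aE.
by apply: eq_bigr => i _; rewrite IHn// ltn_subrL.
Qed.
End Exp.

End FormalExponential.

(** * Actions on finite sets, stabilizers and coset actions *)

Section PermutationActions.
Set Implicit Arguments.
Unset Strict Implicit.
Import GRing.Theory.

(* Equal to 1 when f is not injective. *)
Definition perm_of (T : finType) (f : T -> T) : {perm T} :=
  odflt 1%g [pick s : {perm T} | [forall x, s x == f x]].

Lemma perm_ofE (T : finType) (f : T -> T) : injective f -> perm_of f =1 f.
Proof.
move=> fI x; rewrite /perm_of; case: pickP => [s /forallP/(_ x)/eqP//|].
by move=> /(_ (perm fI)) /negP[]; apply/forallP => y; rewrite permE.
Qed.

Variable G : groupType.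
Local Notation actions X := (@homs G X [set: {perm X}]%G [set: G]).
Local Notation stab phi x := (hom_stab [set: G] phi x).

(** A product of permutations applies its left factor first, so homomorphisms from [G] are right
    actions. *)
Lemma actionsP (X : finType) (phi : G -> {perm X}) :
  actions X phi <-> forall g h x, phi (g * h)%g x = phi h (phi g x).
Proof.
split=> [[_ phiM _] g h x|phiM]; first by rewrite phiM// permM.
split=> [g _|g h _ _|g]; first by rewrite inE.
- by apply/permP => x; rewrite permM phiM.
- by case.
Qed.

Lemma action1 (X : finType) (phi : G -> {perm X}) x :
  actions X phi -> phi 1%g x = x.
Proof.
by move=> /actionsP phiM; apply: (@perm_inj _ (phi 1%g)); rewrite -phiM mulg1.
Qed.

Lemma actionK (X : finType) (phi : G -> {perm X}) g :
  actions X phi -> cancel (phi g) (phi g^-1%g).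
Proof.
by move=> phiA x; have /actionsP phiM := phiA; rewrite -phiM mulgV action1.
Qed.

Lemma actionKV (X : finType) (phi : G -> {perm X}) g :
  actions X phi -> cancel (phi g^-1%g) (phi g).
Proof.
by move=> phiA x; have /actionsP phiM := phiA; rewrite -phiM mulVg action1.
Qed.

Lemma subgroup_stab (X : finType) (phi : G -> {perm X}) x :
  actions X phi -> subgroup (stab phi x).
Proof.
move=> phiA; have /actionsP phiM := phiA; split.
  by apply/mem_set; split=> //; exact: action1.
move=> g h /set_mem[_ gx] /set_mem[_ hx]; apply/mem_set; split=> //.
by rewrite phiM gx -{1}hx actionK.
Qed.

(* Since G acts from the right, left cosets of the stabilizer are the fibres of
   g |-> phi g^-1 x. *)
Lemma left_cosets_stab (X : finType) (phi : G -> {perm X}) x :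
  actions X phi ->
  left_cosets (stab phi x) `<=`
    (fun y => [set g | phi g^-1%g x = y]) @` [set: X].
Proof.
move=> phiA C [g _ <-]; exists (phi g^-1%g x) => //.
have /actionsP phiM := phiA.
apply/seteqP; split=> [h /= hgx|_ [h [_ hx] <-]/=].
  exists (g^-1 * h)%g; last by rewrite mulgA mulgV mul1g.
  by split=> //; rewrite phiM -hgx actionKV.
by rewrite invgM phiM -{1}hx actionK.
Qed.

Lemma finite_index_stab (X : finType) (phi : G -> {perm X}) x :
  actions X phi -> finite_index_subgroups (stab phi x).
Proof.
move=> phiA; split; first exact: subgroup_stab.
by apply: sub_finite_set (left_cosets_stab phiA) _; exact: finite_image.
Qed.

Lemma index_stab_le (X : finType) (phi : G -> {perm X}) x :
  actions X phi -> (index_in (stab phi x) <= #|X|)%N.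
Proof.
move=> phiA; pose F y : set G := [set g | phi g^-1%g x = y].
rewrite /index_in cardE -(size_map F).
apply: uniq_leq_size; first exact: fset_uniq.
move=> C; rewrite in_fset_set; last by have [] := finite_index_stab x phiA.
move=> /set_mem/(left_cosets_stab phiA)[y _ <-].
by apply: (map_f F); rewrite mem_enum.
Qed.

Lemma index_in_gt0 (H : set G) : finite_index_subgroups H -> (0 < index_in H)%N.
Proof.
move=> [_ finH]; rewrite cardfs_gt0; apply/fset0Pn.
exists [set (1 * h)%g | h in H]; rewrite in_fset_set//; apply/mem_set.
by exists 1%g.
Qed.

(** The action is that of [G] on the left cosets of [H], numbered by [enum_rank]; the point [a] is
    the coset [H] itself. *)
Lemma coset_action (H : set G) k : finite_index_subgroups H -> index_in H = k ->
  exists (theta : G -> {perm 'I_k}) (a : 'I_k), [/\ actions 'I_k theta,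
    stab theta a = H & forall b, exists g, theta g a = b].
Proof.
move=> [sgH finH]; pose S := fset_set (left_cosets H).
have -> : index_in H = #|{: S}| by rewrite /index_in cardfE.
move=> <-.
have H1 : H 1%g by apply: set_mem; case: sgH.
have HV g : H g -> H g^-1%g.
  by move=> /mem_set/(group_closedV sgH)/set_mem.
have HM g h : H g -> H h -> H (g * h)%g.
  by move=> Hg Hh; apply/set_mem/(group_closedM sgH); exact: mem_set.
(* Translation by the inverse makes this a right action on left cosets. *)
pose T (g : G) (C : set G) : set G := [set (g^-1 * x)%g | x in C].
have TM g h C : T (g * h)%g C = T h (T g C).
  rewrite /T image_comp; congr image; apply/funext => x /=.
  by rewrite invgM mulgA.
have T1 C : T 1%g C = C.
  rewrite /T -[RHS]image_id; congr image; apply/funext => x.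
  by rewrite invg1 mul1g.
have ST g C : C \in S -> T g C \in S.
  rewrite !in_fset_set// => /set_mem[x _ <-]; apply/mem_set.
  exists (g^-1 * x)%g => //; rewrite /T image_comp; congr image.
  by apply/funext => y /=; rewrite mulgA.
pose f g (i : 'I_#|{: S}|) : 'I_#|{: S}| :=
  enum_rank [` ST g _ (fsvalP (enum_val i))]%fset.
have fM g h i : f (g * h)%g i = f h (f g i).
  apply: enum_val_inj; apply: val_inj; rewrite /f !enum_rankK /=.
  by rewrite TM.
have f1 i : f 1%g i = i.
  by apply: enum_val_inj; apply: val_inj; rewrite /f !enum_rankK /= T1.
have fI g : injective (f g).
  by apply: (can_inj (g := f g^-1%g)) => i; rewrite -fM mulgV f1.
have SH : H \in S.
  rewrite in_fset_set//; apply/mem_set; exists 1%g => //.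
  by rewrite -[RHS]image_id; congr image; apply/funext => x; rewrite mul1g.
exists (fun g => perm_of (f g)), (enum_rank [` SH]%fset); split.
- by apply/actionsP => g h x; rewrite !perm_ofE.
- apply/seteqP; split=> g /=.
    rewrite /hom_stab /= perm_ofE// => -[_ /enum_rank_inj/(congr1 val)/=].
    (* If [g] fixes the coset [H], then 1 lies in [g^-1 H], so [g] lies in [H]. *)
    rewrite enum_rankK /= => TH; have : T g H 1%g by rewrite TH.
    by move=> [x Hx] /eqP; rewrite mulg_eq1 => /eqP/invg_inj ->.
  move=> Hg; split=> //; rewrite perm_ofE//; congr enum_rank; apply: val_inj.
  rewrite /= enum_rankK /=; apply/seteqP; split=> [_ [x Hx <-]|x Hx].
    by apply: HM => //; exact: HV.
  by exists (g * x)%g; [exact: HM|rewrite mulgA mulVg mul1g].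
- move=> b; have := fsvalP (enum_val b).
  rewrite in_fset_set// => /set_mem[g _ gE]; exists g^-1%g.
  rewrite perm_ofE//; apply: enum_val_inj; apply: val_inj.
  by rewrite !enum_rankK /= -gE /T invgK.
Qed.

Lemma action_orbitP (X : finType) (phi : G -> {perm X}) x y :
  reflect (exists g, phi g x = y) (y \in orbit 'P (hom_image [set: G] phi) x).
Proof.
apply: (iffP idP)=> [/imsetP[s + ->]|[g <-]].
  by rewrite inE => /asboolP[g _ <-]; exists g.
by apply/imsetP; exists (phi g); rewrite // inE; apply/asboolP; exists g.
Qed.

Lemma stab_act (X : finType) (phi : G -> {perm X}) g x :
  actions X phi -> stab phi (phi g x) = Defs.conjugate (stab phi x) g.
Proof.
move=> phiA; have /actionsP phiM := phiA; apply/seteqP; split=> [h [_ hx]|].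
  exists (g * h * g^-1)%g; last by rewrite !mulgA mulVg mul1g mulgKV.
  by split=> //; rewrite !phiM hx actionK.
by move=> _ [h [_ hx] <-]; split=> //; rewrite -phiM mulgA mulKVg phiM hx.
Qed.

Lemma orbit_act (X : finType) (phi : G -> {perm X}) g x : actions X phi ->
  orbit 'P (hom_image [set: G] phi) (phi g x) =
    orbit 'P (hom_image [set: G] phi) x.
Proof.
move=> phiA; have /actionsP phiM := phiA; apply/setP => y.
apply/action_orbitP/action_orbitP => [[h <-]|[h <-]]; first by exists (g * h)%g.
by exists (g^-1 * h)%g; rewrite phiM actionK.
Qed.

(** * Transport of stabilizers and orbits along injective equivariant maps *)

Section Equivariance.
Variables (Y X : finType) (f : Y -> X).
Variables (psi : G -> {perm Y}) (phi : G -> {perm X}).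
Hypothesis fI : injective f.
Hypothesis fE : forall g y, f (psi g y) = phi g (f y).

Lemma stab_equivariant y : stab phi (f y) = stab psi y.
Proof.
apply/seteqP; split=> g [_ gy]; split=> //; last by rewrite -fE gy.
by apply: fI; rewrite fE.
Qed.

Lemma orbit_equivariant y :
  orbit 'P (hom_image [set: G] phi) (f y) =
    imset f (mem (orbit 'P (hom_image [set: G] psi) y)).
Proof.
apply/setP => x.
apply/idP/imsetP => [/action_orbitP[g <-]|[z /action_orbitP[g <-] ->]].
  by exists (psi g y); [apply/action_orbitP; exists g|rewrite fE].
by apply/action_orbitP; exists g; rewrite fE.
Qed.

End Equivariance.

(** * Weights of actions *)

Variables (R : comAlgType rat) (Z : set G -> R) (hZ : class_function Z).

Definition orbit_factor (X : finType) (phi : G -> {perm X}) (xi : {set X}) :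
    R :=
  if [pick x in xi] is Some x then Z (stab phi x) else 1.

Definition action_weight (X : finType) (phi : G -> {perm X}) : R :=
  \prod_(xi in hom_orbits [set: G] phi) orbit_factor phi xi.

(** The picked point is a translate of [x], so its stabilizer is conjugate to that of [x], and [Z]
    is a class function. *)
Lemma orbit_factorE (X : finType) (phi : G -> {perm X}) x : actions X phi ->
  orbit_factor phi (orbit 'P (hom_image [set: G] phi) x) = Z (stab phi x).
Proof.
move=> phiA; rewrite /orbit_factor.
case: pickP => [y /action_orbitP[g <-]|/(_ x)].
  by rewrite stab_act// hZ//; exact: finite_index_stab.
by move=> /negP[]; apply/action_orbitP; exists 1%g; exact: action1.
Qed.

(** The image of [A] is a single orbit by transitivity, the other orbits are the images of those of
    [B], and stabilizers are unchanged by the embeddings. *)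
Lemma action_weight_disjoint_union (A B X : finType) (i : A -> X) (j : B -> X)
    (theta : G -> {perm A}) (psi : G -> {perm B}) (phi : G -> {perm X}) a :
  actions A theta -> actions B psi -> actions X phi ->
  injective i -> injective j -> (forall a b, i a <> j b) ->
  (forall x, (exists a, x = i a) \/ (exists b, x = j b)) ->
  (forall g a, i (theta g a) = phi g (i a)) ->
  (forall g b, j (psi g b) = phi g (j b)) ->
  (forall b, exists g, theta g a = b) ->
  action_weight phi = Z (stab theta a) * action_weight psi.
Proof.
move=> thetaA psiA phiA iI jI ij cover iE jE trans.
pose orb Y (rho : G -> {perm Y}) := orbit 'P (hom_image [set: G] rho).
have orbits : hom_orbits [set: G] phi =
    (orb _ phi (i a) |: imset (fun xi : {set B} => imset j (mem xi))
      (mem (hom_orbits [set: G] psi)))%SET.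
  apply/setP => xi; rewrite !inE; apply/imsetP/orP => [[x _ ->]|].
    have [[a' ->]|[b ->]] := cover x; [left|right].
      by have [g <-] := trans a'; rewrite iE /orb orbit_act.
    apply/imsetP; exists (orb _ psi b); first by apply/imsetP; exists b.
    exact: orbit_equivariant.
  case=> [/eqP ->|/imsetP[_ /imsetP[b _ ->] ->]]; first by exists (i a).
  by exists (j b) => //; rewrite (orbit_equivariant jE).
(* The two kinds of orbits are distinct: [i a] is outside the range of [j]. *)
rewrite /action_weight orbits big_setU1/=; last first.
  apply/negP => /imsetP[_ /imsetP[b _ ->]] /setP/(_ (i a)).
  have -> : i a \in orb _ phi (i a).
    by apply/action_orbitP; exists 1%g; exact: action1.
  by move=> /esym/imsetP[b' _ /ij].
rewrite orbit_factorE// (stab_equivariant iI iE); congr (_ * _).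
rewrite big_imset/=; last by move=> ? ? _ _; exact: imset_inj.
apply: eq_bigr => _ /imsetP[b _ ->].
by rewrite -(orbit_equivariant jE) !orbit_factorE// (stab_equivariant jI jE).
Qed.

(** * Finiteness and double counting of weighted actions *)

Hypothesis finG : finitely_generated G.

(** An action is determined by its values on a finite generating sequence, because two actions agree
    on a subgroup. *)
Lemma finite_actions (X : finType) : finite_set (actions X).
Proof.
have [s gen] := finG.
pose r (phi : G -> {perm X}) :=
  [ffun i : 'I_(size s) => phi (tnth (in_tuple s) i)].
have rI : {in actions X &, injective r}.
  move=> phi psi /set_mem phiA /set_mem psiA rE.
  have /actionsP phiM := phiA; have /actionsP psiM := psiA.
  have eqV g : phi g = psi g -> phi g^-1%g = psi g^-1%g.
    move=> E; apply/permP => x; apply: (@perm_inj _ (phi g)).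
    by rewrite actionKV// E actionKV.
  have ET : [set g | phi g = psi g] = [set: G].
    apply: gen; last first.
      move=> g /= gs; have gi : (index g s < size s)%N by rewrite index_mem.
      have := congr1
        (fun f : {ffun 'I_(size s) -> {perm X}} => f (Ordinal gi)) rE.
      by rewrite !ffunE (tnth_nth 1%g)/= nth_index.
    split; first by apply/mem_set/permP => x; rewrite !action1.
    move=> g h /set_mem gE /set_mem hE; apply/mem_set/permP => x.
    by rewrite phiM psiM gE eqV.
  by apply/funext => g; have : [set: G] g by []; rewrite -ET.
by rewrite -(eq_finite_set (inj_card_eq rI)); exact: finite_finset.
Qed.

(** Once [sigma] identifies [X] with [A + B], an action on [X] extending [theta] amounts to an
    arbitrary action on [B], and the weight factors accordingly. *)
Lemma sum_extending_actions (A B X : finType) (theta : G -> {perm A}) a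
    (sigma : A + B -> X) :
  injective sigma -> #|X| = (#|A| + #|B|)%N -> actions A theta ->
  (forall b, exists g, theta g a = b) ->
  \sum_(phi \in actions X) \sum_x
    (if `[< forall g, sigma (inl (theta g a)) = phi g x >]
     then action_weight phi else 0) =
  Z (stab theta a) * \sum_(psi \in actions B) action_weight psi.
Proof.
move=> sigmaI cardX thetaA trans; have /actionsP thetaM := thetaA.
have [|tau sigmaK tauK] := inj_card_bij sigmaI; first by rewrite card_sum cardX.
pose P := [set phi : G -> {perm X} |
  forall g a', sigma (inl (theta g a')) = phi g (sigma (inl a'))].
transitivity (\sum_(phi \in actions X `&` P) action_weight phi).
  rewrite fsbig_mkcondr; apply: eq_fsbigr => phi /set_mem phiA.
  have /actionsP phiM := phiA.
  (* By transitivity of [theta], equivariance on [A] need only be tested at [a]. *)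
  have PE : (phi \in P) =
      `[< forall g, sigma (inl (theta g a)) = phi g (sigma (inl a)) >].
    apply/idP/asboolP => [/set_mem Pphi g|Pphi]; first exact: Pphi.
    apply/mem_set => g a'; have [h <-] := trans a'.
    by rewrite -thetaM !Pphi phiM.
  (* Only [x = sigma (inl a)] contributes, as the condition at [g = 1] shows. *)
  rewrite (bigD1 (sigma (inl a)))//= -PE big1 ?addr0// => x xa.
  case: asboolP => // /(_ 1%g); rewrite !action1// => /esym xE.
  by rewrite xE eqxx in xa.
pose f (t : {perm A}) (s : {perm B}) x := match tau x with
  | inl a => sigma (inl (t a)) | inr b => sigma (inr (s b)) end.
have fI t s : injective (f t s).
  move=> x y; rewrite -{2}(tauK x) -{2}(tauK y) /f.
  by case: (tau x) (tau y) => [?|?] [?|?] /sigmaI // [] /perm_inj ->.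
pose J (psi : G -> {perm B}) g := perm_of (f (theta g) (psi g)).
have Jl (psi : G -> {perm B}) g a' :
    sigma (inl (theta g a')) = J psi g (sigma (inl a')).
  by rewrite perm_ofE// /f sigmaK.
have Jr (psi : G -> {perm B}) g b :
    sigma (inr (psi g b)) = J psi g (sigma (inr b)).
  by rewrite perm_ofE// /f sigmaK.
have cover x : (exists a, x = sigma (inl a)) \/ (exists b, x = sigma (inr b)).
  rewrite -(tauK x).
  by case: (tau x) => [a'|b]; [left; exists a'|right; exists b].
have JA psi : actions B psi -> actions X (J psi).
  move=> /actionsP psiM; apply/actionsP => g h x.
  have [[a' ->]|[b ->]] := cover x; first by rewrite -!Jl thetaM.
  by rewrite -!Jr psiM.
have Jbij : set_bij (actions B) (actions X `&` P) J.
  split=> [psi psiA|psi psi' _ _ JE|phi [phiA Pphi]].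
  - by split; [exact: JA|move=> g a'; exact: Jl].
  - apply/funext => g; apply/permP => b.
    have := congr1 (fun J' : G -> {perm X} => J' g (sigma (inr b))) JE.
    by rewrite /= -!Jr => /sigmaI [].
  (* The image of [B] is stable: if [g] moved one of its points into the image of [A], then [g^-1]
     would move a point out of the image of [A]. *)
  have phir g b : exists b', phi g (sigma (inr b)) = sigma (inr b').
    have [[a' phiE]|[b' ->]] := cover (phi g (sigma (inr b)));
      last by exists b'.
    have := congr1 (phi g^-1%g) phiE; rewrite actionK// -Pphi.
    by move=> /sigmaI.
  have [q qE] : exists q : G -> B -> B,
      forall g b, phi g (sigma (inr b)) = sigma (inr (q g b)).
    exists (fun g b => projT1 (cid (phir g b))) => g b.
    exact: (projT2 (cid (phir g b))).
  have qI g : injective (q g).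
    by move=> b b' qb; have := qE g b; rewrite qb -qE => /perm_inj/sigmaI [].
  have /actionsP phiM := phiA.
  exists (fun g => perm_of (q g)).
    apply/actionsP => g h b; rewrite !perm_ofE//.
    by apply/inr_inj/sigmaI; rewrite -!qE phiM.
  apply/funext => g; apply/permP => x; have [[a' ->]|[b ->]] := cover x.
    by rewrite -Jl Pphi.
  by rewrite -Jr perm_ofE.
rewrite (reindex_fsbig J _ _ _ Jbij) !fsbig_finite; try exact: finite_actions.
rewrite big_distrr/= !big_seq; apply: eq_bigr => psi psiS.
have psiA : actions B psi.
  by move: psiS; rewrite in_fset_set; [move=> /set_mem|exact: finite_actions].
by apply: action_weight_disjoint_union (JA _ psiA) (inj_comp sigmaI inl_inj)
  (inj_comp sigmaI inr_inj) _ cover (Jl psi) (Jr psi) trans => // ? ? /sigmaI.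
Qed.

(** Such a [sigma] is the same as an injection of [B] into the complement of the image of [f], which
    has as many points as [B]. *)
Lemma card_injective_extensions (A B X : finType) (f : A -> X) :
  injective f -> #|X| = (#|A| + #|B|)%N ->
  #|finset (fun sigma : {ffun A + B -> X} =>
     injectiveb sigma && [forall a, sigma (inl a) == f a])| = (#|B|)`!.
Proof.
move=> fI cardX; pose D : {set X} := finset (fun x => x \notin codom f).
have cardD : #|D| = #|B|.
  apply/eqP; rewrite -(eqn_add2l #|A|) -cardX -(card_codom fI).
  rewrite -[X in _ == X](cardC (mem (codom f))) eqn_add2l.
  by apply/eqP/eq_card => x; rewrite !inE.
pose ext (rho : {ffun B -> X}) : {ffun A + B -> X} :=
  [ffun s => match s with inl a => f a | inr b => rho b end].
have extI : injective ext.
  move=> rho rho' /ffunP E; apply/ffunP => b.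
  by have := E (inr b); rewrite !ffunE.
rewrite -[#|B| in RHS]cardD -ffactnn {2}cardD -card_inj_ffuns_on.
rewrite -(card_imset _ extI); apply: eq_card => sigma; rewrite inE.
apply/andP/imsetP => [[sI /forallP sf]|[rho]].
  have {}sI := injectiveP _ sI.
  exists [ffun b => sigma (inr b)]; last first.
    by apply/ffunP => -[a|b]; rewrite !ffunE//; exact/eqP.
  rewrite inE; apply/andP; split.
    apply/ffun_onP => b; rewrite ffunE inE; apply/negP => /codomP[a].
    by rewrite -(eqP (sf a)) => /sI.
  by apply/injectiveP => b b'; rewrite !ffunE => /sI [].
rewrite inE => /andP[/ffun_onP rhoD /injectiveP rhoI] ->; split; last first.
  by apply/forallP => a; rewrite ffunE.
have fD a b : f a <> rho b.
  by move=> E; have := rhoD b; rewrite inE -E codom_f.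
by apply/injectiveP => -[a|b] [a'|b']; rewrite !ffunE;
  [move=> /fI ->|move=> /fD|move=> /esym/fD|move=> /rhoI ->].
Qed.

Definition total_weight (X : finType) : R :=
  \sum_(phi \in actions X) action_weight phi.

(** Both sides sum the weight of [phi] over triples [(sigma, phi, x)] in which the injection [sigma]
    restricts to the orbit map of [x]. The left side counts [sigma] for fixed [(phi, x)], the right
    side fixes [sigma] first. *)
Lemma total_weight_stab (X : finType) (H : set G) :
  finite_index_subgroups H -> (index_in H <= #|X|)%N ->
  (#|X| - index_in H)`!%:R * (\sum_(phi \in actions X) \sum_x
    (if `[< stab phi x = H >] then action_weight phi else 0)) =
  (#|X|)`!%:R * (Z H * total_weight 'I_(#|X| - index_in H)).
Proof.
move=> finH; move kE : (index_in H) => k kX; set m := (#|X| - k)%N.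
have [theta [a [thetaA stabE trans]]] := coset_action finH kE.
have cardX : #|X| = (#|'I_k| + #|'I_m|)%N by rewrite !card_ord subnKC.
pose I := finset (fun sigma : {ffun 'I_k + 'I_m -> X} => injectiveb sigma).
have cardI : #|I| = (#|X|)`!.
  by rewrite card_inj_ffuns card_sum -cardX ffactnn.
pose S (sigma : {ffun 'I_k + 'I_m -> X}) (phi : G -> {perm X}) x :=
  `[< forall g, sigma (inl (theta g a)) = phi g x >].
have count phi x : actions X phi ->
    \sum_(sigma in I) (if S sigma phi x then action_weight phi else 0) =
    m`!%:R * (if `[< stab phi x = H >] then action_weight phi else 0).
  move=> phiA; have /actionsP phiM := phiA; have /actionsP thetaM := thetaA.
  case: asboolP => [phiH|phiH]; last first.
    (* A single admissible [sigma] would already force the stabilizer of [x] to be [H]. *)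
    rewrite mulr0; apply: big1 => sigma; rewrite inE => /injectiveP sI.
    rewrite /S; case: asboolP => // SE; case: phiH; rewrite -stabE.
    have xE : x = sigma (inl a) by rewrite -[a](action1 _ thetaA) SE action1.
    apply/seteqP; split=> g [_ gx]; split=> //; last by rewrite -SE gx.
    by apply/inl_inj/sI; rewrite SE gx.
  (* Both equations say that [g * h^-1] lies in [H], so the orbit map [f] below is well defined and
     injective. *)
  have fwd g h : (theta g a = theta h a) <-> (phi g x = phi h x).
    have E Y (rho : G -> {perm Y}) y : actions Y rho ->
        rho g y = rho h y <-> stab rho y (g * h^-1)%g.
      move=> rhoA; have /actionsP rhoM := rhoA; rewrite /hom_stab /= rhoM.
      split=> [->|[_ gh]]; first by split=> //; exact: actionK.
      by rewrite -{2}gh actionKV.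
    by rewrite !E// stabE phiH.
  pose r b := projT1 (cid (trans b)).
  have rE b : theta (r b) a = b by exact: (projT2 (cid (trans b))).
  pose f b := phi (r b) x.
  have fE g : f (theta g a) = phi g x by apply/fwd; exact: rE.
  have fI : injective f.
    by move=> b b'; rewrite /f => /fwd; rewrite !rE.
  rewrite -big_mkcondr/= sumr_const mulr_natl; congr (_ *+ _).
  rewrite -[in RHS](card_ord m) -(card_injective_extensions fI cardX).
  apply: eq_card => sigma; rewrite -topredE/= !inE; congr andb.
  apply/asboolP/forallP => [SE b|SE g]; last by rewrite (eqP (SE _)) fE.
  by rewrite -[b in inl b]rE SE.
have finX := finite_actions X.
transitivity (\sum_(phi \in actions X) \sum_x \sum_(sigma in I)
    (if S sigma phi x then action_weight phi else 0)).
  rewrite !fsbig_finite// big_distrr/= !big_seq; apply: eq_bigr => phi.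
  rewrite in_fset_set// => /set_mem phiA.
  by rewrite big_distrr/=; apply: eq_bigr => x _; rewrite count.
transitivity (\sum_(sigma in I) \sum_(phi \in actions X) \sum_x
    (if S sigma phi x then action_weight phi else 0)).
  rewrite fsbig_finite//; under eq_bigr => phi _ do rewrite exchange_big.
  rewrite exchange_big/=; apply: eq_bigr => sigma _.
  by rewrite fsbig_finite.
transitivity (\sum_(sigma in I) Z H * total_weight 'I_m).
  apply: eq_bigr => sigma; rewrite inE => /injectiveP sI.
  by rewrite (sum_extending_actions sI cardX thetaA trans) stabE.
by rewrite sumr_const cardI mulr_natl.
Qed.

(** * Subgroups of given index and the recursion for Z_n(G) *)

Definition subgroups_of_index k : set (set G) :=
  [set H | finite_index_subgroups H /\ index_in H = k].

(** Each of these subgroups is a point stabilizer of one of the finitely many actions on [k]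
    points. *)
Lemma finite_subgroups_of_index k : finite_set (subgroups_of_index k).
Proof.
apply: (@sub_finite_set _ _
  ((fun p : (G -> {perm 'I_k}) * 'I_k => stab p.1 p.2) @`
     (actions 'I_k `*` [set: 'I_k]))).
  move=> H [finH kE]; have [theta [a [thetaA <- _]]] := coset_action finH kE.
  by exists (theta, a).
by apply/finite_image/finite_setX; [exact: finite_actions|exact: finite_finset].
Qed.

(** This is Z_n(G), in a form that is uniform in [n] and includes [n = 0]. *)
Definition orbifold_coef n : R := (n`!%:R^-1 : rat) *: total_weight 'I_n.

(** Both sides are [1 / n!] times the sum of weights over pairs [(phi, x)]: on the left [x] takes
    [n] values, on the right pairs are grouped by the stabilizer of [x]. *)
Lemma orbifold_coef_rec n : n%:R * orbifold_coef n =
  \sum_(k < n)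
    (\sum_(H \in subgroups_of_index k.+1) Z H) * orbifold_coef (n - k.+1).
Proof.
have finS k := finite_subgroups_of_index k.
have natN0 m : (m`!%:R : rat) != 0.
  by rewrite Num.Theory.pnatr_eq0 -lt0n fact_gt0.
pose T H := \sum_(phi \in actions 'I_n) \sum_x
  (if `[< stab phi x = H >] then action_weight phi else 0).
(* This is [total_weight_stab] divided by both factorials. *)
have TE k H : (k < n)%N -> subgroups_of_index k.+1 H ->
    Z H * orbifold_coef (n - k.+1) = (n`!%:R^-1 : rat) *: T H.
  move=> kn [finH kE]; have := @total_weight_stab 'I_n H finH.
  rewrite kE card_ord -/(T H) => /(_ kn) E.
  rewrite /orbifold_coef -scalerAr; apply: (scalerI (natN0 n)).
  rewrite [RHS]scalerA divff// scale1r; apply: (scalerI (natN0 (n - k.+1)%N)).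
  rewrite !scalerA mulrAC divff// mul1r.
  by rewrite !scaler_nat -[in LHS]mulr_natl -E mulr_natl.
under eq_bigr => k _.
  rewrite fsbig_finite// big_distrl/= big_seq.
  under eq_bigr => H.
    rewrite in_fset_set// => /set_mem Hk; rewrite (TE k)//.
    over.
  rewrite -big_seq -scaler_sumr.
  over.
rewrite -scaler_sumr /orbifold_coef -scalerAr; congr (_ *: _).
have finA := finite_actions 'I_n.
rewrite /total_weight /T fsbig_finite// big_distrr/=.
under [RHS]eq_bigr => k _.
  under eq_bigr => H _ do rewrite fsbig_finite//.
  rewrite exchange_big/=; under eq_bigr => phi _ do rewrite exchange_big.
  over.
rewrite exchange_big/= big_seq [RHS]big_seq; apply: eq_bigr => phi.
rewrite in_fset_set// => /set_mem phiA; rewrite exchange_big/=.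
rewrite -[n in n%:R]card_ord mulr_natl -sumr_const; apply: eq_bigr => x _.
(* For a fixed pair the stabilizer has index between 1 and [n], so exactly one [k] and one [H]
   contribute. *)
have finstab := finite_index_stab x phiA.
have := index_stab_le x phiA; have := index_in_gt0 finstab.
rewrite card_ord; case kE : (index_in _) => [//|k] _ kn.
rewrite (bigD1 (Ordinal kn))//= (bigD1_seq (stab phi x))/=; first last.
- exact: fset_uniq.
- by rewrite in_fset_set//; exact/mem_set.
rewrite asboolT// !big1 ?addr0// => [j jk|H Hx]; last first.
  by rewrite asboolF// => /esym/eqP; rewrite (negPf Hx).
rewrite big_seq big1// => H; rewrite in_fset_set// => /set_mem[_ HE].
rewrite asboolF// => HE'; move: jk; rewrite -val_eqE/= -eqSS -kE -HE HE'.
by rewrite eqxx.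
Qed.

(** For positive [n] the symmetric group has order [n!]. For [n = 0] the only action has no orbits,
    and its empty product agrees with the convention Z_0 = 1. *)
Lemma sym_transformE n : sym_transform Z n [set: G] = orbifold_coef n.
Proof.
case: n => [|n]; last by rewrite /= /orbifold_transform cardsT card_Sn.
rewrite /orbifold_coef /total_weight.
have -> : actions 'I_0 = [set fun=> 1%g].
  apply/seteqP; split=> [phi _|_ ->].
    by apply/funext => g; apply/permP => -[].
  by apply/actionsP => g h [].
rewrite fsbig_set1 /action_weight big1 ?invr1 ?scale1r//.
by move=> xi /imsetP[[]].
Qed.

End PermutationActions.

Theorem theorem2 (G : groupType) (R : comAlgType rat) (Z : set G -> R)
    (hG : finitely_generated G) (hZ : class_function Z) :
  fps_sum [set: nat] (fun n => sym_transform Z n [set: G] *: fps_var R ^+ n) =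
  fps_exp (fps_sum (@finite_index_subgroups G)
    (fun H => (((index_in H)%:R^-1 : rat) *: Z H) *: fps_var R ^+ index_in H)).
Proof.
apply/esym; have -> : fps_sum [set: nat]
    (fun n => sym_transform Z n [set: G] *: fps_var R ^+ n) =
    orbifold_coef Z.
  apply/funext => n; rewrite fps_sum_monomials.
  have -> : [set: nat] `&` [set m | m = n] = [set n].
    by rewrite setTI; apply/seteqP; split.
  by rewrite fsbig_set1 (sym_transformE Z).
apply: fps_exp_unique => [||n].
(* The exponent has no constant term because every index is at least 1. *)
- rewrite fps_sum_monomials fsbig1// => H [finH H0].
  by have := index_in_gt0 finH; rewrite H0.
- by rewrite -sym_transformE.
- rewrite (orbifold_coef_rec hZ hG); apply: eq_bigr => k _.
  congr (_ * _); rewrite fps_sum_monomials !fsbig_finite; first last.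
  - exact: finite_subgroups_of_index.
  - exact: finite_subgroups_of_index.
  rewrite GRing.mulr_sumr !big_seq; apply: eq_bigr => H.
  rewrite in_fset_set; last exact: finite_subgroups_of_index.
  (* The factor [k.+1] produced by the Euler operator cancels the denominator [[G : H]]. *)
  move=> /set_mem[finH HE]; rewrite HE GRing.mulr_natl -GRing.scaler_nat.
  by rewrite GRing.scalerA GRing.divff ?GRing.scale1r// Num.Theory.pnatr_eq0.
Qed.
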